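(* Let $\nu$ be a probability distribution on $\mathbb{N}=\{0,1,2,\ldots\}$ with $\nu(0)<1$ and expectation $\bar\nu=\sum_{k\ge0}k\,\nu(k)$, let $\rho>0$, and let $(S_n,\mathcal{T}_n)_{n\ge 0}$ be the $(\rho,\nu)$-TBRW. Suppose that $\rho>1+2\bar\nu$. Then there exist positive constants $c_1=c_1(\rho,\nu)$ and $c_2=c_2(\rho,\nu)$ such that, almost surely, $$c_1\log n\le|\mathcal{T}_n|\le c_2\log n\qquad\text{for all } n \text{ large enough}.$$
   Context: Definition of the $(\rho,\nu)$-tree builder random walk (TBRW): it is a random growing sequence of rooted trees $(\mathcal{T}_n)_{n\ge 0}$ together with a walk $S_n\in\mathcal{T}_n$. At time $0$, $\mathcal{T}_0$ is a single vertex $o$ (the root) and $S_0=o$. Inductively, given $\mathcal{T}_n$ and $S_n$: first, independently of everything else, draw $\xi_n$ with law $\nu$ and obtain $\mathcal{T}_{n+1}$ from $\mathcal{T}_n$ by attaching $\xi_n$ new leaves (children) to the vertex $S_n$; second, if $S_n=v$ has father $v^0$ and children $v^1,\ldots,v^k$ in $\mathcal{T}_{n+1}$, then $S_{n+1}=v^0$ with probability $\frac{\rho}{k+\rho}$ and $S_{n+1}=v^i$ with probability $\frac{1}{k+\rho}$ for each $1\le i\le k$. By convention, the father of the root $o$ is $o$ itself (loop at the root). For a vertex $w$, $|w|$ denotes its height, i.e. its graph distance to the root $o$; $|\mathcal{T}_n|:=\max_{w\in\mathcal{T}_n}|w|$. ``For all $n$ large enough'' means for all $n\ge n_0$ with $n_0$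 a (random) almost surely finite index. *)

(* Defs.v *)
From HB Require Import structures.
From mathcomp Require Import all_boot all_order all_algebra.
From mathcomp Require Import finmap.
From mathcomp Require Import all_classical all_reals all_analysis.

Set Implicit Arguments.
Unset Strict Implicit.
Unset Printing Implicit Defensive.

Import Order.TTheory GRing.Theory Num.Theory.

Local Open Scope classical_set_scope.
Local Open Scope ring_scope.

(* Ulam-Harris labelling: a vertex is the word of the child indices read from
   the root, which is the empty word. *)
Definition vertex : choiceType := seq nat.
Definition tree_root : vertex := [::].

(* Deletes the last letter. In particular [father tree_root] is [tree_root],
   which is the convention of the loop at the root. *)
Definition father (v : vertex) : vertex := take (size v).-1 v.

Definition tree : choiceType := {fset vertex}.

Definition children (T : tree) (v : vertex) : {fset vertex} :=
  [fset w in T | (w != tree_root) && (father w == v)]%fset.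

(* The labels already used by the children of [v] are 0, ..., k-1, where k is
   their number, so that the [m] attached leaves are new. *)
Definition attach (T : tree) (v : vertex) (m : nat) : tree :=
  (T `|` [fset rcons v i | i in iota #|` children T v| m])%fset.

Definition edge (T : tree) : rel vertex := fun u v =>
  [&& u \in T, v \in T & (father v == u) || (father u == v)].

Definition walk_length (T : tree) (u v : vertex) (n : nat) : Prop :=
  exists p : seq vertex, [/\ path (edge T) u p, last u p = v & size p = n].

(* The default value 0 is used only if [u] and [v] are not connected. *)
Definition graph_distance (T : tree) (u v : vertex) : nat :=
  xget 0%N [set n | walk_length T u v n /\
                    forall m, walk_length T u v m -> (n <= m)%N].

Definition height (T : tree) : nat :=
  (\max_(w <- enum_fset T) graph_distance T tree_root w)%N.

Definition step_prob (R : realType) (rho : R) (T : tree) (v w : vertex) : R :=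
  let k := #|` children T v|%:R in
  if w == father v then rho / (k + rho)
  else if w \in children T v then (k + rho)^-1
  else 0.

Definition mean (R : realType) (nu : probability nat R) : \bar R :=
  (\sum_(0 <= k <oo) k%:R%:E * nu [set k])%E.

(* The event that the trajectory up to the beginning of step [n] is prescribed
   by [t], [s] and [x]: the variables xi_i with i < n, and T_i and S_i with
   i <= n. These variables are discrete, so conditioning on the past amounts to
   conditioning on these events. *)
Definition past (Omega : Type)
    (T : nat -> Omega -> tree) (S : nat -> Omega -> vertex)
    (xi : nat -> Omega -> nat)
    (n : nat) (t : nat -> tree) (s : nat -> vertex) (x : nat -> nat) :
    set Omega :=
  [set om | (forall i, (i <= n)%N -> T i om = t i /\ S i om = s i) /\
            (forall i, (i < n)%N -> xi i om = x i)].

Record is_TBRW (R : realType) (d : measure_display) (Omega : measurableType d)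
    (P : probability Omega R) (rho : R) (nu : probability nat R)
    (T : nat -> Omega -> tree) (S : nat -> Omega -> vertex)
    (xi : nat -> Omega -> nat) : Prop := {
  tbrw_measurable_tree : forall n t, measurable [set om | T n om = t];
  tbrw_measurable_walk : forall n v, measurable [set om | S n om = v];
  tbrw_measurable_leaves : forall n k, measurable [set om | xi n om = k];
  tbrw_tree0 : forall om, T 0%N om = [fset tree_root]%fset;
  tbrw_walk0 : forall om, S 0%N om = tree_root;
  (* xi_n has law nu and is independent of the past *)
  tbrw_leaves : forall n t s x k,
    (P (past T S xi n t s x `&` [set om | xi n om = k]) =
     P (past T S xi n t s x) * nu [set k])%E;
  tbrw_treeS : forall n om, T n.+1 om = attach (T n om) (S n om) (xi n om);
  (* the conditional law of S_(n+1) given the past, xi_n and T_(n+1) *)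
  tbrw_walkS : forall n t s x k t' v,
    let A := past T S xi n t s x `&`
             [set om | xi n om = k /\ T n.+1 om = t'] in
    (P (A `&` [set om | S n.+1 om = v]) =
     P A * (step_prob rho t' (s n) v)%:E)%E
}.

(* Main.v *)
Require Import Defs.
From HB Require Import structures.
From mathcomp Require Import all_boot all_order all_algebra.
From mathcomp Require Import all_classical all_reals all_analysis.
From mathcomp Require Import finmap ring lra.

Import Order.TTheory GRing.Theory Num.Theory.

Local Open Scope classical_set_scope.
Local Open Scope ring_scope.

Set Implicit Arguments.
Unset Strict Implicit.
Unset Printing Implicit Defensive.

(** Upper bound. Let [m] be the mean of [nu] and [mu = (rho - 1 - m) / m]; the
    assumption on [rho] says that [mu > 1]. When the walk is at [s], a vertex
    [v] with [k] children gets the weight [mu ^ |v| * rho ^ (- D) * (k + rho)],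
    where [D] is the distance from [v] to the path from the root to [s]. The
    total weight of the tree is a supermartingale as long as the walk avoids the
    loop at the root. Indeed, a step to a child [w] multiplies by [rho] the
    weights of the descendants of [w], [w] included, and a step to the father
    divides by [rho] those of the descendants of [s]. As the odds are [1] for
    each child and [rho] for the father, the mean gain and the mean loss cancel,
    except that [s] itself can only lose: this amounts to
    [(rho - 1) * mu ^ |s|]. On the other hand a new leaf adds [mu ^ |s|] to the
    weight of [s] and brings its own weight [mu ^ (|s| + 1)], and
    [m * (1 + mu) = rho - 1] for this choice of [mu].

    The loop at the root does not change the weights; a factor [1 / rho] for
    each loop restores the supermartingale ([discounted_weight_drift]). After
    [n] steps the position [s] thus satisfies
    [mu ^ |s| <= (n + 1) ^ 3 * rho ^ L] eventually, where [L] is the number of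
    loops. Finally [L = O(log n)], because each visit of the root creates a
    child with at least a fixed positive probability, and a loop has probability
    [rho / (K + rho)] when the root has [K] children: for [y > 1] close to 1,
    [y ^ L / (K + rho)] is a supermartingale ([loop_weight_drift]), while
    [K <= (n + 1) ^ 3] eventually since the mean of [K] is at most [m * n].

    Lower bound. Whatever the past, the walk steps to a child with probability
    at least [p = (1 - nu(0)) / (1 + rho)], so it descends [H] times in a row
    within a time of order [p ^ (- H)]. The function [descent_gap] turns this
    into a bound [(1 - (1 - p) * p ^ H) ^ n / (1 - p)] for the probability that
    the height is less than [H] after [n] steps. It is summable when
    [H = c * log n] with [c] small.

    All these functions depend on the history only, that is, on the numbers of
    leaves and the positions so far. Each one is controlled by its mean over one
    step ([mean_drift]), and the bound on its expectations becomes an almost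
    sure one by the inequality of Markov and the Borel-Cantelli lemma
    ([eventually_not_hist]). *)

(** * Rooted trees of words *)

Lemma father_rcons (v : vertex) i : father (rcons v i) = v.
Proof. by rewrite /father size_rcons -cats1 /= take_size_cat. Qed.

Lemma size_father (v : vertex) : size (father v) = (size v).-1.
Proof. by rewrite /father size_takel // leq_pred. Qed.

Lemma childrenP (T : tree) (v w : vertex) :
  reflect (exists2 i, w = rcons v i & w \in T) (w \in children T v).
Proof.
apply: (iffP idP) => [|[i -> vT]].
  rewrite !inE => /and3P[wT w0 /eqP fw].
  case/lastP: w w0 wT fw => // w i _ wT; rewrite father_rcons => wv.
  by exists i; rewrite -?wv.
by rewrite !inE vT father_rcons eqxx andbT /=; case: (v).
Qed.

Definition leaves (v : vertex) k m : tree :=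
  [fset rcons v i | i in iota k m]%fset.

Lemma leavesP (v w : vertex) k m :
  reflect (exists2 i, w = rcons v i & (k <= i < k + m)%N)
          (w \in leaves v k m).
Proof.
apply: (iffP (imfsetP _ _ _ _)) => [[i /= + ->]|[i -> ki]].
  by rewrite mem_iota; exists i.
by exists i => //=; rewrite mem_iota.
Qed.

Lemma card_leaves (v : vertex) k m : #|` leaves v k m| = m.
Proof.
rewrite card_imfset /=; last by move=> i j /rcons_inj[].
by rewrite undup_id ?iota_uniq // size_iota.
Qed.

(** The condition on the labels is what makes the leaves of [attach] new. *)
Definition well_formed (T : tree) : Prop :=
  [/\ tree_root \in T,
      forall v, v \in T -> father v \in T &
      forall v i, rcons v i \in T -> (i < #|` children T v|)%N].

Lemma well_formed_root : well_formed [fset tree_root]%fset.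
Proof.
split=> [|v|v i]; rewrite ?inE ?eqxx //; first by move=> /eqP ->.
by case: v.
Qed.

Section Attach.
Variables (T : tree) (s : vertex) (m : nat).
Hypotheses (wfT : well_formed T) (sT : s \in T).

Let k := #|` children T s|.

Lemma attachE : attach T s m = (T `|` leaves s k m)%fset.
Proof. by []. Qed.

Lemma leaves_new : [disjoint T & leaves s k m]%fset.
Proof.
apply/fdisjointP_sym => w /leavesP[i -> /andP[ki _]].
by apply/negP => /(let: And3 _ _ h := wfT in h); rewrite ltnNge ki.
Qed.

Lemma children_attach (v : vertex) :
  children (attach T s m) v =
  if v == s then (children T s `|` leaves s k m)%fset else children T v.
Proof.
apply/fsetP => w; case: eqVneq => [->|vs].
  apply/childrenP/fsetUP => [[i ->]|].
    rewrite attachE => /fsetUP[]; last by right.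
    by left; apply/childrenP; exists i.
  case=> [/childrenP[i -> iT]|/leavesP[i -> ki]]; exists i => //;
    rewrite attachE; apply/fsetUP; first by left.
  by right; apply/leavesP; exists i.
apply/childrenP/childrenP => -[i -> iT]; exists i => //; last first.
  by apply/fsetUP; left.
case/fsetUP: iT => // /leavesP[j /rcons_inj[vs' _]].
by rewrite vs' eqxx in vs.
Qed.

Lemma card_children_attach (v : vertex) :
  #|` children (attach T s m) v| = (#|` children T v| + (v == s) * m)%N.
Proof.
rewrite children_attach; case: eqVneq => [->|_]; last by rewrite addn0.
rewrite mul1n cardfsU card_leaves (_ : _ `&` _ = fset0)%fset ?cardfs0 ?subn0 //.
apply/eqP/fdisjointP => w /childrenP[i _ wT].
exact: (fdisjointP leaves_new).
Qed.

Lemma well_formed_attach : well_formed (attach T s m).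
Proof.
case: wfT => rT fT lT; split.
- by apply/fsetUP; left.
- move=> v /fsetUP[/fT fv|/leavesP[i -> _]]; apply/fsetUP; left => //.
  by rewrite father_rcons.
- move=> v i /fsetUP[/lT iv|/leavesP[j /rcons_inj[-> ->]]].
    by rewrite card_children_attach ltn_addr.
  by rewrite card_children_attach eqxx mul1n => /andP[].
Qed.

Lemma card_children_leaf (w : vertex) :
  w \in leaves s k m -> #|` children (attach T s m) w| = 0%N.
Proof.
move=> wl; rewrite card_children_attach; case: (eqVneq w s) => [ws|_].
  by move: wl; rewrite ws (negbTE (fdisjointP leaves_new _ sT)).
rewrite addn0; apply/eqP; rewrite cardfs_eq0; apply/eqP/fsetP => u.
rewrite in_fset0; apply/negbTE/negP => /childrenP[i ->].
move/(let: And3 _ h _ := wfT in h); rewrite father_rcons => wT.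
by move: (fdisjointP leaves_new _ wT); rewrite wl.
Qed.

End Attach.

Definition successors (T : tree) (v : vertex) : {fset vertex} :=
  (father v |` children T v)%fset.

Lemma father_notin_children (T : tree) (v : vertex) :
  father v \notin children T v.
Proof.
apply/negP => /childrenP[i /(congr1 size)]; rewrite size_father size_rcons.
by move=> h _; have := leq_pred (size v); rewrite h ltnn.
Qed.

Lemma successors_in (T : tree) (v w : vertex) :
  well_formed T -> v \in T -> w \in successors T v -> w \in T.
Proof.
case=> _ fT _ vT; rewrite in_fset1U => /orP[/eqP ->|/childrenP[]//].
exact: fT.
Qed.

(** * Heights *)

Definition depth (T : tree) : nat := (\max_(w <- enum_fset T) size w)%N.

Lemma leq_depth (T : tree) (v : vertex) : v \in T -> (size v <= depth T)%N.
Proof. by move=> vT; rewrite /depth (big_rem v) //= leq_maxl. Qed.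

Lemma depth_leq (T : tree) n :
  (forall v, v \in T -> (size v <= n)%N) -> (depth T <= n)%N.
Proof.
by move=> h; rewrite /depth; apply/bigmax_leqP_seq => w wT _; exact: h.
Qed.

Lemma walk_to_root (T : tree) (v : vertex) : well_formed T -> v \in T ->
  walk_length T tree_root v (size v).
Proof.
move=> wT; have [_ fT _] := wT; elim/last_ind: v => [_|v i IH vT].
  by exists [::].
have vT' : v \in T by have := fT _ vT; rewrite father_rcons.
have [p [pp pv sp]] := IH vT'; exists (rcons p (rcons v i)); split.
- by rewrite rcons_path pp pv /edge vT vT' father_rcons eqxx.
- by rewrite last_rcons.
- by rewrite !size_rcons sp.
Qed.

(** Along an edge the length of the word changes by at most one. *)
Lemma size_walk (T : tree) (u v : vertex) n :
  walk_length T u v n -> (size v <= size u + n)%N.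
Proof.
case=> p [+ <- <-]; elim: p u => [|w p IH] u /=; first by rewrite addn0.
case/andP=> /and3P[_ _ uw] /IH h; apply: (leq_trans h).
rewrite addnS -addSn leq_add2r.
case/orP: uw => /eqP <-; rewrite size_father; first exact: leqSpred.
by rewrite (leq_trans (leq_pred _)).
Qed.

Lemma graph_distance_root (T : tree) (v : vertex) :
  well_formed T -> v \in T -> graph_distance T tree_root v = size v.
Proof.
move=> wT vT; rewrite /graph_distance; case: xgetP => [n _ [wn mn]|/(_ (size v))].
  apply/eqP; rewrite eqn_leq mn; last exact: walk_to_root.
  by have := size_walk wn; rewrite add0n.
case; split=> [|m /size_walk]; last by rewrite add0n.
exact: walk_to_root.
Qed.

Lemma height_depth (T : tree) : well_formed T -> height T = depth T.
Proof.
move=> wT; rewrite /height /depth; apply: eq_big_seq => v vT.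
exact: graph_distance_root.
Qed.

(** * Histories and their law *)

(** A history lists the pairs (xi_i, S_(i+1)), the latest first. The histories
    form a countable type, and the tree and the position are functions of the
    history, so that every event below is a countable union of atoms. *)
Definition history : countType := seq (nat * seq nat).

Definition walk_of (h : history) : vertex :=
  if h is (_, v) :: _ then v else tree_root.

Fixpoint tree_of (h : history) : tree :=
  if h is (k, _) :: h' then attach (tree_of h') (walk_of h') k
  else [fset tree_root]%fset.

Fixpoint root_loops (h : history) : nat :=
  if h is (_, v) :: h' then
    (root_loops h' + ((walk_of h' == tree_root) && (v == tree_root :> vertex)))%N
  else 0%N.

Definition branching_tree (h : history) (k : nat) : tree :=
  attach (tree_of h) (walk_of h) k.

(** The other histories have probability 0; on these ones the tree is well
    formed and contains the position of the walk. *)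
Fixpoint admissible (h : history) : bool :=
  if h is (k, v) :: h' then
    admissible h' && ((v : vertex) \in successors (branching_tree h' k) (walk_of h'))
  else true.

Lemma admissible_tree (h : history) : admissible h ->
  well_formed (tree_of h) /\ walk_of h \in tree_of h.
Proof.
elim: h => [_|[k v] h IH /= /andP[/IH[wT sT] vs]].
  by split; [exact: well_formed_root | rewrite inE].
have wA := well_formed_attach k wT sT.
split=> //; apply: (successors_in wA _ vs).
by apply/fsetUP; left.
Qed.

Definition step_mean (R : realType) (rho : R) (T : tree) (s : vertex)
    (G : vertex -> R) : R :=
  (rho * G (father s) + \sum_(w <- enum_fset (children T s)) G w) /
  (#|` children T s|%:R + rho).

Lemma step_mean_ge0 (R : realType) (rho : R) (T : tree) s (G : vertex -> R) :
  0 < rho -> (forall v, 0 <= G v) -> 0 <= step_mean rho T s G.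
Proof.
move=> r0 G0; rewrite divr_ge0 ?addr_ge0 ?mulr_ge0 ?(ltW r0) ?sumr_ge0 //.
Qed.

Lemma esum_fset_seq (R : realType) (I : choiceType) (X : {fset I})
    (a : I -> \bar R) : (forall i, (0 <= a i)%E) ->
  (forall i, i \notin X -> a i = 0%E) ->
  (\esum_(i in setT) a i = \sum_(i <- enum_fset X) a i)%E.
Proof.
move=> a0 aX.
transitivity (\esum_(i in [set` X]) a i)%E.
  rewrite [RHS]esum_mkcond; apply: eq_esum => i _.
  by case: ifPn => //; rewrite notin_setE /= => /negP /aX.
rewrite esum_fset ?finite_fset // fsbig_finite ?finite_fset //=.
by rewrite set_fsetK.
Qed.

Lemma esum_step_prob (R : realType) (rho : R) (T : tree) s (G : vertex -> R) :
  0 < rho -> (forall v, 0 <= G v) ->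
  (\esum_(v in setT) (step_prob rho T s v * G v)%:E =
   (step_mean rho T s G)%:E)%E.
Proof.
move=> r0 G0.
rewrite (@esum_fset_seq _ _ (successors T s)); last 2 first.
- move=> v; rewrite lee_fin mulr_ge0 // /step_prob.
  case: ifP => _; first by rewrite divr_ge0 ?addr_ge0 // ltW.
  by case: ifP => _ //; rewrite invr_ge0 addr_ge0 // ltW.
- move=> v; rewrite in_fset1U negb_or /step_prob => /andP[/negbTE -> /negbTE ->].
  by rewrite mul0r.
rewrite big_fsetU1 ?father_notin_children //= /step_mean mulrDl EFinD.
congr (_ + _)%E; first by rewrite /step_prob eqxx mulrAC.
rewrite sumEFin mulr_suml; congr (_%:E); apply: eq_big_seq => w wc.
rewrite /step_prob wc; case: eqVneq => [wf|_]; last by rewrite mulrC.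
by move: wc; rewrite wf (negbTE (father_notin_children _ _)).
Qed.

Lemma esum_le_mull (R : realType) (I : choiceType) (c : \bar R)
    (a : I -> \bar R) (J : set I) : (0 <= c)%E -> (forall i, (0 <= a i)%E) ->
  (\esum_(i in J) (c * a i) <= c * \esum_(i in J) a i)%E.
Proof.
move=> c0 a0; apply: ge_ereal_sup => _ [X [finX XJ]] <-.
rewrite -ge0_mule_fsumr //; apply: lee_wpmul2l => //.
by apply: esum_ge; exists X.
Qed.

Section OffspringLaw.
Variables (R : realType) (nu : probability nat R).
Hypothesis hmean : (mean nu < +oo)%E.
Local Open Scope ereal_scope.

Lemma mean_ge0 : 0 <= mean nu.
Proof. by apply: nneseries_ge0 => k _ _; rewrite mule_ge0 // lee_fin. Qed.

Lemma mean_fin : mean nu \is a fin_num.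
Proof. by rewrite ge0_fin_numE ?mean_ge0. Qed.

Lemma nu_fin (A : set nat) : nu A \is a fin_num.
Proof. exact: fin_num_measure. Qed.

Lemma nu_total : \sum_(0 <= k <oo) nu [set k] = 1.
Proof.
rewrite -(@probability_setT _ _ _ nu).
have -> : [set: nat] = \bigcup_(k in setT) [set k].
  by apply/seteqP; split => // k _; exists k.
rewrite measure_bigcup //; last by move=> i j _ _ [x [/= -> ->]].
by apply: eq_eseriesl => k; rewrite in_setT.
Qed.

(** The mean of [nu] and its mass at 0 are all that the drifts depend on: they
    are computed from bounds which are affine in the number of leaves, with a
    correction when there is no leaf. *)
Lemma law_affine (a b c : R) (X : nat -> R) :
  (0 <= a)%R -> (0 <= b)%R -> (0 <= c)%R -> (forall k, 0 <= X k)%R ->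
  (forall k, X k <= a + b * k%:R + c * (k == 0%N)%:R)%R ->
  \esum_(k in setT) (nu [set k] * (X k)%:E) <=
  (a + b * fine (mean nu) + c * fine (nu [set 0%N]))%:E.
Proof.
move=> a0 b0 c0 X0 Xle.
rewrite -nneseries_esumT; last by move=> k; rewrite mule_ge0 ?lee_fin.
apply: (@le_trans _ _ (\sum_(0 <= k <oo) (a%:E * nu [set k] +
  (b%:E * (k%:R%:E * nu [set k]) + c%:E * ((k == 0%N)%:R%:E * nu [set k]))))).
  apply: lee_nneseries => k _; first by rewrite mule_ge0 ?lee_fin.
  rewrite -(fineK (nu_fin [set k])) -!EFinM -!EFinD lee_fin.
  have := Xle k; have : (0 <= fine (nu [set k]))%R by rewrite fine_ge0.
  move: (fine _) => q q0 /(ler_wpM2l q0) /le_trans; apply.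
  by rewrite le_eqVlt; apply/orP; left; apply/eqP; ring.
have n0 k : (0 : \bar R) <= nu [set k] by [].
rewrite nneseriesD; last 2 first.
- by move=> k _ _; rewrite mule_ge0 ?lee_fin.
- by move=> k _ _; rewrite adde_ge0 ?mule_ge0 ?lee_fin.
rewrite nneseriesD; last 2 first.
- by move=> k _ _; rewrite mule_ge0 ?lee_fin // mule_ge0.
- by move=> k _ _; rewrite !mule_ge0 ?lee_fin.
rewrite !nneseriesZl //; try by move=> k _; rewrite ?mule_ge0 ?lee_fin.
rewrite nu_total -/(mean nu) mule1.
rewrite (_ : \sum_(0 <= k <oo) _ = nu [set 0%N]); last first.
  rewrite nneseries_recl //; last by move=> k _; rewrite mule_ge0.
  rewrite mul1e eseries0 ?adde0 //.
  by move=> [|k] // _ _; rewrite mul0e.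
by rewrite !EFinD !EFinM !fineK ?mean_fin ?nu_fin // addeA.
Qed.

End OffspringLaw.

(** * Expectations along the process *)

(** The mean of [F] after one step is at most [alpha * F + beta]. Given the
    history and the number [k] of leaves, the mean over the position is bounded
    by an affine function of [k], corrected at [k = 0], so that the mean over
    [k] can be read off. *)
Definition mean_drift (R : realType) (nu : probability nat R) (rho : R)
    (F : history -> R) (alpha beta : R) : Prop :=
  forall h, admissible h -> exists a b c, [/\ 0 <= a, 0 <= b, 0 <= c,
    forall k, step_mean rho (branching_tree h k) (walk_of h)
      (fun v => F ((k, v) :: h)) <= a + b * k%:R + c * (k == 0%N)%:R &
    a + b * fine (mean nu) + c * fine (nu [set 0%N]) <= alpha * F h + beta].

Section Process.
Variables (R : realType) (nu : probability nat R) (rho : R).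
Variables (d : measure_display) (Omega : measurableType d).
Variables (P : probability Omega R) (T : nat -> Omega -> tree)
  (S : nat -> Omega -> vertex) (xi : nat -> Omega -> nat).
Hypothesis rho_gt0 : 0 < rho.
Hypothesis HT : is_TBRW P rho nu T S xi.

Fixpoint hist (n : nat) (om : Omega) : history :=
  if n is n'.+1 then (xi n' om, S n'.+1 om) :: hist n' om else [::].

Lemma hist_pos n om : S n om = walk_of (hist n om).
Proof. by case: n => [|n] //=; rewrite (tbrw_walk0 HT). Qed.

Lemma hist_tree n om : T n om = tree_of (hist n om).
Proof.
elim: n => [|n IH] /=; first by rewrite (tbrw_tree0 HT).
by rewrite (tbrw_treeS HT) IH hist_pos.
Qed.

Lemma hist_eq n om om0 : hist n om = hist n om0 ->
  forall i, (i <= n)%N -> hist i om = hist i om0.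
Proof.
elim: n => [|n IH] /= ; first by move=> _ [|i].
move=> E i; rewrite leq_eqVlt => /predU1P[->//|]; rewrite ltnS; apply: IH.
by case: E.
Qed.

Lemma pastE n om0 :
  past T S xi n (T^~ om0) (S^~ om0) (xi^~ om0) =
  [set om | hist n om = hist n om0].
Proof.
apply/seteqP; split => om /=.
  case=> h1 h2; elim: n h1 h2 => [|n IH] //= h1 h2.
  rewrite (h1 n.+1 _).2 // h2 // IH // => i ni.
  - by apply: h1; exact: leqW.
  - by apply: h2; exact: leqW.
move=> /hist_eq E; split=> i ni; first by rewrite !hist_tree !hist_pos E.
by have := E i.+1 ni => /= -[].
Qed.

Definition atom_prob n (h : history) : \bar R :=
  P [set om | hist n om = h].

Lemma measurable_atom n (h : history) : measurable [set om | hist n om = h].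
Proof.
elim: n h => [|n IH] [|[k v] h] /=.
- by rewrite (_ : [set _ | _] = setT) //; apply/seteqP; split.
- by rewrite (_ : [set _ | _] = set0) //; apply/seteqP; split.
- by rewrite (_ : [set _ | _] = set0) //; apply/seteqP; split.
rewrite (_ : [set _ | _] = [set om | xi n om = k] `&`
  [set om | S n.+1 om = v] `&` [set om | hist n om = h]); last first.
  apply/seteqP; split=> om /=; first by case=> -> -> ->.
  by case=> -[-> ->] ->.
apply: measurableI; last exact: IH.
apply: measurableI; first exact: (tbrw_measurable_leaves HT).
exact: (tbrw_measurable_walk HT).
Qed.

Local Open Scope ereal_scope.

Lemma atom_prob0 h : atom_prob 0 h = (h == [::])%:R%:E.
Proof.
rewrite /atom_prob /=; case: eqVneq => [->|h0].
  rewrite (_ : [set _ | _] = setT) ?probability_setT //.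
  by apply/seteqP; split.
rewrite (_ : [set _ | _] = set0) ?measure0 //; apply/seteqP; split => // om /=.
by move=> h1; rewrite h1 eqxx in h0.
Qed.

Lemma atom_prob_nil n : atom_prob n.+1 [::] = 0.
Proof.
by rewrite /atom_prob (_ : [set _ | _] = set0) ?measure0 //; apply/seteqP; split.
Qed.

(** Conditioning on the atom [h] is conditioning on the past of any outcome
    [om0] of that atom, because the past trees are functions of the history. *)
Lemma atom_prob_cons n k v (h : history) :
  atom_prob n.+1 ((k, v) :: h) =
  atom_prob n h *
    (nu [set k] * (step_prob rho (branching_tree h k) (walk_of h) v)%:E).
Proof.
have [[om0 E]|nE] := pselect (exists om0, hist n om0 = h); last first.
  have e1 : [set om | hist n om = h] = set0.
    by apply/seteqP; split => // om E; apply: nE; exists om.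
  rewrite /atom_prob e1 measure0 mul0e (_ : [set _ | _] = set0) ?measure0 //.
  by apply/seteqP; split => // om [_ _ E]; apply: nE; exists om.
set t' := branching_tree h k.
have L := tbrw_leaves HT n (T^~ om0) (S^~ om0) (xi^~ om0) k.
have W := tbrw_walkS HT n (T^~ om0) (S^~ om0) (xi^~ om0) k t' v.
move: L W; rewrite pastE E => L /=.
have e2 : [set om | xi n om = k /\ T n.+1 om = t'] `&`
    [set om | hist n om = h] =
    [set om | hist n om = h] `&` [set om | xi n om = k].
  apply/seteqP; split=> om /=; first by case=> -[-> _].
  by case=> Eh Ek; rewrite (tbrw_treeS HT) hist_tree hist_pos Eh Ek.
rewrite [X in P (X `&` _)]setIC [X in P X * _]setIC e2 L -muleA.
rewrite hist_pos E => <-; congr (P _); apply/seteqP; split => om /=.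
  by case=> -> -> ->.
by case=> -[-> ->] ->.
Qed.

Lemma atom_prob_inadmissible n h : ~~ admissible h -> atom_prob n h = 0.
Proof.
elim: h n => [|[k v] h IH] // [|n]; first by rewrite atom_prob0.
rewrite /= negb_and atom_prob_cons => /orP[/IH ->|vS]; first by rewrite mul0e.
suff -> : step_prob rho (branching_tree h k) (walk_of h) v = 0%R by rewrite !mule0.
move: vS; rewrite in_fset1U negb_or /step_prob.
by move=> /andP[/negbTE -> /negbTE ->].
Qed.

(** The atoms are numbered to reduce to countable additivity. *)
Lemma prob_hist n (B : set history) :
  P [set om | B (hist n om)] = \esum_(h in B) atom_prob n h.
Proof.
pose a (j : nat) := P [set om | choice.pickle (hist n om) = j].
have aE h : atom_prob n h = a (choice.pickle h).
  congr (P _); apply/seteqP; split => om /=; first by move=> ->.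
  exact: (pcan_inj choice.pickleK).
under eq_esum do rewrite aE.
rewrite -(@esum_image _ _ _ B (@choice.pickle history) a); last first.
  by move=> x y _ _; exact: (pcan_inj choice.pickleK).
have ma j : measurable [set om | choice.pickle (hist n om) = j].
  case: (pselect (exists h : history, choice.pickle h = j)) => [[h hj]|nj].
    rewrite (_ : [set _ | _] = [set om | hist n om = h]).
      exact: measurable_atom.
    apply/seteqP; split => om /=; last by move=> ->.
    by rewrite -hj; exact: (pcan_inj choice.pickleK).
  rewrite (_ : [set _ | _] = set0) //.
  by apply/seteqP; split => // om ?; apply: nj; exists (hist n om).
transitivity (\sum_(j <oo | j \in choice.pickle @` B) a j); last first.
  rewrite nneseries_esum //; congr (esum _ _).
  by apply/seteqP; split => x /= => [/set_mem|/mem_set].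
rewrite -(@measure_bigcup _ _ _ P (choice.pickle @` B)
  (fun j => [set om | choice.pickle (hist n om) = j])) //; last first.
  by move=> i j _ _ [om [/= <- <-]].
congr (P _); apply/seteqP; split => om /=.
  by move=> Bh; exists (choice.pickle (hist n om)) => //; exists (hist n om).
by case=> j [h Bh <-] /= /(pcan_inj choice.pickleK) ->.
Qed.

Lemma measurable_hist n (B : set history) :
  measurable [set om | B (hist n om)].
Proof.
rewrite (_ : [set _ | _] =
    \bigcup_(h : history) if `[< B h >] then [set om | hist n om = h] else set0).
  apply: countable_bigcupT_measurable; first exact: countableP.
  by move=> h; case: ifP => // _; exact: measurable_atom.
apply/seteqP; split => om /=.
  by move=> Bh; exists (hist n om) => //; rewrite (asboolT Bh).
by case=> h _; case: asboolP => // Bh /= ->.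
Qed.

Lemma atom_prob_total n : \esum_(h in setT) atom_prob n h = 1.
Proof.
by rewrite -prob_hist (_ : [set _ | _] = setT) ?probability_setT //.
Qed.

Definition expectation_hist n (F : history -> R) : \bar R :=
  \esum_(h in setT) (atom_prob n h * (F h)%:E).

Lemma expectation_hist0 F : (0 <= F [::])%R ->
  expectation_hist 0 F = (F [::])%:E.
Proof.
move=> F0; rewrite /expectation_hist -[RHS](esum_set1 (T := history) (t := [::])
  (a := fun h => (F h)%:E)) ?lee_fin // [RHS]esum_mkcond.
apply: eq_esum => h _; rewrite atom_prob0; case: eqVneq => [->|h0].
  by rewrite mul1e mem_set.
by rewrite mul0e memNset //= => /eqP; rewrite (negbTE h0).
Qed.

Lemma expectation_histS n (F : history -> R) : (forall h, 0 <= F h)%R ->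
  expectation_hist n.+1 F <=
  \esum_(h in setT) (atom_prob n h * \esum_(k in setT) (nu [set k] *
    (step_mean rho (branching_tree h k) (walk_of h)
       (fun v => F ((k, v) :: h)))%:E)).
Proof.
move=> F0; rewrite /expectation_hist.
have p0 h m : 0 <= atom_prob m h by [].
have s0 T' s v : (0 <= step_prob rho T' s v)%R.
  rewrite /step_prob; case: ifP => _.
    by rewrite divr_ge0 ?addr_ge0 // ltW.
  by case: ifP => _ //; rewrite invr_ge0 addr_ge0 // ltW.
rewrite (esumID [set [::]]); last by move=> h _; rewrite mule_ge0 ?lee_fin.
rewrite esum1 ?add0e; last by move=> h [_ /= ->]; rewrite atom_prob_nil mul0e.
rewrite (@reindex_esum _ _ _ (setT `*`` (fun=> setT `*`` (fun=> setT))) _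
  (fun x : history * (nat * seq nat) => (x.2.1, x.2.2) :: x.1)); last first.
  split.
  - by move=> x _; split.
  - by move=> [x1 [x2 x3]] [y1 [y2 y3]] _ _ /= [-> -> ->].
  - by move=> [|[k v] h] [_ /= h0] //; exists (h, (k, v)).
rewrite -(@esum_esum _ _ _ setT (fun=> setT `*`` (fun=> setT))
  (fun h kv => atom_prob n.+1 ((kv.1, kv.2) :: h) *
    (F ((kv.1, kv.2) :: h))%:E)); last first.
  by move=> h kv _ _; rewrite mule_ge0 ?lee_fin.
apply: le_esum => h _.
rewrite -(@esum_esum _ _ _ setT (fun=> setT)
  (fun k v => atom_prob n.+1 ((k, v) :: h) * (F ((k, v) :: h))%:E)); last first.
  by move=> k v _ _; rewrite mule_ge0 ?lee_fin.
apply: (le_trans _ (esum_le_mull _ _ _)) => //; last first.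
  by move=> k; rewrite mule_ge0 ?lee_fin // step_mean_ge0.
apply: le_esum => k _; rewrite -esum_step_prob //.
rewrite muleA; apply: (le_trans _ (esum_le_mull _ _ _)) => //; last 2 first.
- by rewrite mule_ge0.
- by move=> v; rewrite lee_fin mulr_ge0.
apply: le_esum => v _.
by rewrite atom_prob_cons EFinM !muleA.
Qed.

Hypothesis hmean : mean nu < +oo.

Lemma expectation_drift n (F : history -> R) (alpha beta : R) :
  (forall h, 0 <= F h)%R -> (0 <= alpha)%R -> (0 <= beta)%R ->
  mean_drift nu rho F alpha beta ->
  expectation_hist n.+1 F <= alpha%:E * expectation_hist n F + beta%:E.
Proof.
move=> F0 al0 be0 dF; apply: (le_trans (expectation_histS _ F0)).
have p0 h m : 0 <= atom_prob m h by [].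
apply: (@le_trans _ _ (\esum_(h in setT) (alpha%:E * (atom_prob n h * (F h)%:E) +
    beta%:E * atom_prob n h))).
  apply: le_esum => h _; have [adh|nadh] := boolP (admissible h); last first.
    by rewrite atom_prob_inadmissible // !(mul0e, mule0, adde0).
  rewrite muleCA [beta%:E * _]muleC -ge0_muleDr ?lee_fin ?mulr_ge0 //.
  have [a [b [c [a0 b0 c0 Fabc abcF]]]] := dF h adh.
  apply: lee_wpmul2l => //.
  apply: (@le_trans _ _ (a + b * fine (mean nu) + c * fine (nu [set 0%N]))%:E);
    last by rewrite lee_fin abcF.
  by apply: law_affine => // k; rewrite step_mean_ge0.
rewrite esumD; last 2 first.
- by move=> h _; rewrite !mule_ge0 ?lee_fin.
- by move=> h _; rewrite !mule_ge0 ?lee_fin.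
apply: leeD; first by apply: esum_le_mull => // h; rewrite mule_ge0 ?lee_fin.
apply: (le_trans (esum_le_mull _ _ _)) => //.
by rewrite atom_prob_total mule1.
Qed.

Lemma expectation_linear n (F : history -> R) (beta : R) :
  (forall h, 0 <= F h)%R -> (0 <= beta)%R -> mean_drift nu rho F 1 beta ->
  expectation_hist n F <= (F [::] + beta * n%:R)%:E.
Proof.
move=> F0 be0 dF; elim: n => [|n IH].
  by rewrite expectation_hist0 // mulr0 addr0.
apply: (le_trans (expectation_drift n F0 ler01 be0 dF)); rewrite mul1e.
apply: (le_trans (leeD IH (lexx _))).
by rewrite -EFinD lee_fin -natr1 mulrDr mulr1 addrA.
Qed.

Lemma expectation_geometric n (F : history -> R) (alpha : R) :
  (forall h, 0 <= F h)%R -> (0 <= alpha)%R -> mean_drift nu rho F alpha 0 ->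
  expectation_hist n F <= (alpha ^+ n * F [::])%:E.
Proof.
move=> F0 al0 dF; elim: n => [|n IH].
  by rewrite expectation_hist0 // expr0 mul1r.
apply: (le_trans (expectation_drift n F0 al0 (lexx _) dF)); rewrite adde0.
by rewrite exprS -mulrA EFinM lee_wpmul2l.
Qed.

Lemma markov_hist n (F : history -> R) (B : set history) (a : R) :
  (0 < a)%R -> (forall h, 0 <= F h)%R ->
  (forall h, admissible h -> B h -> a <= F h)%R ->
  P [set om | B (hist n om)] <= (a^-1)%:E * expectation_hist n F.
Proof.
move=> a0 F0 BF; rewrite prob_hist.
have p0 h m : 0 <= atom_prob m h by [].
have ai : (0 <= a^-1)%R by rewrite invr_ge0 ltW.
apply: (le_trans _ (esum_le_mull _ _ _)) => //; last first.
  by move=> h; rewrite mule_ge0 ?lee_fin.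
rewrite esum_mkcond; apply: le_esum => h _.
case: ifPn => [/set_mem Bh|_]; last by rewrite !mule_ge0 ?lee_fin.
have [adh|nadh] := boolP (admissible h); last first.
  by rewrite atom_prob_inadmissible // mul0e mule0.
rewrite muleCA -EFinM -{1}(mule1 (atom_prob n h)) lee_wpmul2l // lee_fin.
by rewrite mulrC ler_pdivlMr // mul1r BF.
Qed.

Lemma sum_inv_sqr_lty (C : R) : (0 <= C)%R ->
  \sum_(0 <= n <oo) (C / n.+1%:R ^+ 2)%:E < +oo.
Proof.
move=> C0; apply: (@le_lt_trans _ _ (C * 2)%:E); last exact: ltry.
apply: lime_le.
  by apply: is_cvg_nneseries => n _ _; rewrite lee_fin divr_ge0 // exprn_ge0.
apply: nearW => N; rewrite sumEFin lee_fin -mulr_sumr ler_wpM2l //.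
(* 1 / (n + 1) ^ 2 <= 2 / (n + 1) - 2 / (n + 2), which telescopes *)
have: (\sum_(0 <= n < N) (n.+1%:R ^+ 2)^-1 <= 2 - 2 / N.+1%:R :> R)%R.
  elim: N => [|N IH]; first by rewrite big_nil divr1 subrr.
  rewrite big_nat_recr //=; apply: (le_trans (lerD IH (lexx _))).
  have N0 : (0 < N.+1%:R :> R)%R by rewrite ltr0n.
  rewrite -[N.+2%:R]natr1; move: (N.+1%:R) N0 (ler1n R N.+1) => x x0.
  rewrite ltn0Sn => x1.
  rewrite -subr_ge0 (_ : _ - _ = (x - 1) / (x ^+ 2 * (x + 1)))%R; last first.
    by field; rewrite !gt_eqF // addr_gt0.
  by rewrite divr_ge0 ?subr_ge0 ?mulr_ge0 ?exprn_ge0 ?addr_ge0 // ltW.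
by move=> /le_trans; apply; rewrite gerBl divr_ge0.
Qed.

Lemma eventually_not_hist (B : nat -> set history) (C : R) : (0 <= C)%R ->
  (forall n, P [set om | B n (hist n om)] <= (C / n.+1%:R ^+ 2)%:E) ->
  {ae P, forall om, \forall n \near \oo, ~ B n (hist n om)}.
Proof.
move=> C0 PB; pose F n := [set om | B n (hist n om)].
have mF n : measurable (F n) by exact: measurable_hist.
exists (lim_sup_set F); split.
- by apply: bigcapT_measurable => n; exact: bigcup_measurable.
- apply: lim_sup_set_cvg0 => //; apply: le_lt_trans (sum_inv_sqr_lty C0).
  by apply: lee_nneseries => // n _; exact: PB.
- move=> om /= nBom n _ ; apply: contrapT => nF; apply: nBom.
  exists n => // j /= nj Bj; apply: nF; by exists j.
Qed.

(** When the expectations grow at most linearly, the inequality of Markov at the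
    level [(n + 1) ^ 3] has a summable right-hand side. *)
Lemma eventually_le_cube (F : history -> R) (C : R) : (0 <= C)%R ->
  (forall h, 0 <= F h)%R ->
  (forall n, expectation_hist n F <= (C * n.+1%:R)%:E) ->
  {ae P, forall om, \forall n \near \oo,
    admissible (hist n om) /\ (F (hist n om) <= n.+1%:R ^+ 3)%R}.
Proof.
move=> C0 F0 EF.
pose B (n : nat) : set history :=
  [set h | ~~ admissible h \/ (n.+1%:R ^+ 3 < F h)%R].
have PB n : P [set om | B n (hist n om)] <= (C / n.+1%:R ^+ 2)%:E.
  have n0 : (0 < n.+1%:R :> R)%R by rewrite ltr0n.
  apply: (le_trans (markov_hist (a := (n.+1%:R ^+ 3)%R) n _ F0 _)).
  - by rewrite exprn_gt0.
  - by move=> h adh [/negP//|/ltW].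
  apply: (@le_trans _ _ (((n.+1%:R ^+ 3)^-1)%:E * (C * n.+1%:R)%:E)).
    by rewrite lee_wpmul2l // lee_fin invr_ge0 exprn_ge0 // ltW.
  rewrite -EFinM lee_fin le_eqVlt; apply/orP; left; apply/eqP; field.
  by rewrite gt_eqF.
have := eventually_not_hist C0 PB; apply: filterS => om.
apply: filterS => n /not_orP[/negP]; rewrite negbK => -> /negP.
by rewrite -leNgt.
Qed.

End Process.

(** * Means over one step *)

Section StepMean.
Variables (R : realType) (rho : R).
Hypothesis rho_gt0 : 0 < rho.

Lemma sum_cst_seq (I : Type) (r : seq I) (c : R) :
  \sum_(w <- r) c = c * (size r)%:R.
Proof. by rewrite big_const_seq count_predT iter_addr_0 mulr_natr. Qed.

Lemma card_rho_gt0 (T : tree) (s : vertex) : 0 < #|` children T s|%:R + rho.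
Proof. by rewrite ltr_wpDl. Qed.

Lemma step_mean_cst (T : tree) (s : vertex) (c : R) (G : vertex -> R) :
  (forall v, G v = c) -> step_mean rho T s G = c.
Proof.
move=> Gc; rewrite /step_mean Gc (eq_bigr (fun=> c)) // sum_cst_seq.
rewrite [rho * c]mulrC -mulrDr [rho + _]addrC mulfK //.
by rewrite gt_eqF // card_rho_gt0.
Qed.

End StepMean.

Lemma tree_of_cons (h : history) k v :
  tree_of ((k, v) :: h) = branching_tree h k.
Proof. by []. Qed.

Lemma card_children_branching (h : history) k v : admissible h ->
  #|` children (branching_tree h k) v| =
  (#|` children (tree_of h) v| + (v == walk_of h) * k)%N.
Proof.
by move=> /admissible_tree[wT sT]; exact: card_children_attach.
Qed.

(** * The children of the root and the loops *)

Definition root_degree (h : history) : nat := #|` children (tree_of h) tree_root|.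

Section Loops.
Variables (R : realType) (nu : probability nat R) (rho : R).
Hypothesis rho_gt1 : 1 < rho.
Let rho_gt0 : 0 < rho. Proof. exact: lt_trans ltr01 rho_gt1. Qed.

Lemma root_degree_drift :
  mean_drift nu rho (fun h => (root_degree h)%:R) 1 (fine (mean nu)).
Proof.
move=> h adh; exists (root_degree h)%:R, 1, 0; split=> //; last first.
  by rewrite !mul1r mul0r addr0.
move=> k; rewrite mul1r mul0r addr0.
rewrite (@step_mean_cst _ _ rho_gt0 _ _ (root_degree ((k, [::]) :: h))%:R) //.
rewrite /root_degree tree_of_cons card_children_branching // -natrD ler_nat.
by rewrite leq_add2l; case: (_ == _); rewrite ?mul1n.
Qed.

(** A loop multiplies [y ^ L] by [y], but it has a probability of order
    [1 / K] when the root has [K] children. Each visit of the root creates a new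
    child with a fixed probability, which decreases [1 / (K + rho)] by a relative
    amount of the same order: this compensates the loops if [y - 1] is small. *)
Definition loop_weight (y : R) (h : history) : R :=
  y ^+ root_loops h / ((root_degree h)%:R + rho).

Lemma loop_weight_ge0 y h : 0 <= y -> 0 <= loop_weight y h.
Proof. by move=> y0; rewrite divr_ge0 ?exprn_ge0 // ltW // card_rho_gt0. Qed.

Lemma loop_weight_mean_off_root y (h : history) k : admissible h ->
  walk_of h != tree_root ->
  step_mean rho (branching_tree h k) (walk_of h)
    (fun v => loop_weight y ((k, v) :: h)) = loop_weight y h.
Proof.
move=> adh s0; apply: step_mean_cst => // v.
rewrite /loop_weight /= (negbTE s0) addn0 /root_degree tree_of_cons.
by rewrite card_children_branching // eq_sym (negbTE s0) addn0.
Qed.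

Lemma loop_weight_mean_root y (h : history) k : admissible h ->
  walk_of h = tree_root ->
  let u := (root_degree h)%:R + rho + k%:R in
  step_mean rho (branching_tree h k) (walk_of h)
    (fun v => loop_weight y ((k, v) :: h)) =
  y ^+ root_loops h / u * (1 + rho * (y - 1) / u).
Proof.
move=> adh s0 u; rewrite /step_mean s0.
rewrite (eq_big_seq (fun=> y ^+ root_loops h / u)); last first.
  move=> w; rewrite /loop_weight /= s0 eqxx => /childrenP[i -> _].
  rewrite (_ : (rcons _ i == _) = false); last by case: i.
  rewrite addn0 /root_degree tree_of_cons card_children_branching //.
  by rewrite s0 eqxx mul1n natrD addrAC.
rewrite sum_cst_seq /loop_weight /= s0 !eqxx addn1 /root_degree tree_of_cons.
rewrite card_children_branching // s0 eqxx mul1n natrD -/(root_degree h).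
have -> : (root_degree h)%:R + k%:R + rho = u by rewrite /u addrAC.
have u0 : u != 0 by rewrite gt_eqF // /u ltr_wpDr // ltr_wpDl.
have -> : ((root_degree h)%:R + k%:R : R) = u - rho by rewrite /u; ring.
rewrite exprS; field.
exact: u0.
Qed.

Lemma loop_weight_drift (y : R) : (nu [set 0%N] < 1)%E ->
  rho * (y - 1) = (1 - fine (nu [set 0%N])) / 2 ->
  mean_drift nu rho (loop_weight y) 1 0.
Proof.
move=> nu01; set nu0 := fine _; pose p0 := 1 - nu0.
have p00 : 0 < p0 by rewrite subr_gt0 -lte_fin fineK ?nu_fin.
have p01 : p0 <= 1 by rewrite gerBl fine_ge0.
have nu0E : nu0 = 1 - p0 by rewrite /p0; ring.
rewrite nu0E subKr => hy h adh.
have y1 : 1 <= y.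
  rewrite -subr_ge0 -(pmulr_rge0 _ rho_gt0) hy; lra.
have y0 : 0 <= y by lra.
have [s0|s0] := eqVneq (walk_of h) tree_root; last first.
  exists (loop_weight y h), 0, 0; split=> //; first exact: loop_weight_ge0.
    by move=> k; rewrite loop_weight_mean_off_root // !mul0r !addr0.
  by rewrite !mul0r !addr0 mul1r.
have Y0 : 0 <= y ^+ root_loops h by rewrite exprn_ge0.
rewrite /loop_weight; set Y := y ^+ root_loops h in Y0 *.
set u := _ + rho; have u1 : 1 < u by rewrite /u ltr_wpDl.
pose e := 1 + p0 / 2 / u.
have e0 : 0 <= e by rewrite /e addr_ge0 // !divr_ge0 //; lra.
have u0 : u != 0 by rewrite gt_eqF //; lra.
have u10 : u + 1 != 0 by rewrite gt_eqF //; lra.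
(* The factor of the loop is bounded by [e], its value without new leaf; with
   new leaves, [1 / u] becomes at most [1 / (u + 1)]. *)
exists (Y / (u + 1) * e), 0, (Y / (u * (u + 1)) * e); split=> //.
- by rewrite mulr_ge0 // divr_ge0 //; lra.
- by rewrite mulr_ge0 // divr_ge0 // mulr_ge0 //; lra.
- move=> j; rewrite loop_weight_mean_root // -/u -/Y hy mul0r addr0.
  case: j => [|j] /=.
    rewrite mulr1 addr0 -/e le_eqVlt; apply/orP; left; apply/eqP.
    rewrite -mulrDl; congr (_ * _); field.
    by rewrite u0 u10.
  rewrite mulr0 addr0; have j1 : (1 : R) <= j.+1%:R by rewrite ler1n.
  have uj : 0 < u + j.+1%:R by lra.
  apply: ler_pM.
  + by rewrite divr_ge0 // ltW.
  + by rewrite addr_ge0 // divr_ge0 //; lra.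
  + by rewrite ler_wpM2l // lef_pV2 ?posrE //; lra.
  + by rewrite lerD2l ler_wpM2l //; [lra | rewrite lef_pV2 ?posrE //; lra].
- rewrite mul0r !addr0 mul1r -/nu0 nu0E -subr_ge0.
  have -> : Y / u - (Y / (u + 1) * e + Y / (u * (u + 1)) * e * (1 - p0)) =
     Y / (u ^+ 2 * (u + 1)) * (p0 / 2) * (u - 1 + p0).
    by rewrite /e; field; rewrite u0 u10.
  rewrite !mulr_ge0 // ?invr_ge0 ?mulr_ge0 ?exprn_ge0 //; lra.
Qed.

End Loops.

(** * The weight of a tree *)

Fixpoint common_prefix_size (u v : seq nat) : nat :=
  match u, v with
  | a :: u', b :: v' => if a == b then (common_prefix_size u' v').+1 else 0%N
  | _, _ => 0%N
  end.

Lemma common_prefix_size_rcons (v q : seq nat) i :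
  common_prefix_size v (rcons q i) =
  (common_prefix_size v q + prefix (rcons q i) v)%N.
Proof.
elim: q v => [|b q IH] [|a v] //=.
  by rewrite [a == i]eq_sym; case: (i == a) => //; case: v.
by rewrite [a == b]eq_sym; case: (b == a) => //; rewrite IH addSn.
Qed.

Lemma common_prefix_size_id (v : seq nat) : common_prefix_size v v = size v.
Proof. by elim: v => //= a v ->; rewrite eqxx. Qed.

Lemma common_prefix_size_rconsl (v : seq nat) i :
  common_prefix_size (rcons v i) v = size v.
Proof. by elim: v => //= a v ->; rewrite eqxx. Qed.

(** A word has a single prefix of each length: at most one child of [s] is a
    prefix of [v], and none is if [v = s]. *)
Lemma count_children_prefix (T : tree) (s v : vertex) :
  ((v == s) + count (fun w => prefix w v) (enum_fset (children T s)) <=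
   prefix s v)%N.
Proof.
have ch w : w \in enum_fset (children T s) -> prefix w v ->
    [/\ prefix s v, v != s & w == take (size s).+1 v].
  move=> /childrenP[i -> _] pv; split.
  - by apply: prefix_trans pv; exact: prefix_rcons.
  - by apply/eqP => E; move: (size_prefix pv); rewrite E size_rcons ltnn.
  - by move: pv; rewrite prefixE size_rcons eq_sym.
have [/hasP[w wc pw]|] :=
    boolP (has (fun w => prefix w v) (enum_fset (children T s))).
  have [-> /negbTE -> _] := ch _ wc pw; rewrite add0n.
  apply: (@leq_trans (count_mem (take (size s).+1 v) (enum_fset (children T s)))).
    rewrite -!sum1_count [leqLHS]big_mkcond [leqRHS]big_mkcond.
    rewrite [leqLHS]big_seq [leqRHS]big_seq; apply: leq_sum => x /ch /=.
    by case: (prefix x v) => // /(_ isT)[_ _ ->].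
  by rewrite count_uniq_mem ?fset_uniq // leq_b1.
rewrite has_count -leqNgt leqn0 => /eqP ->; rewrite addn0.
by case: eqVneq => [->|//]; rewrite prefix_refl.
Qed.

Section Weight.
Variables (R : realType) (rho mu : R).
Hypotheses (rho_gt1 : 1 < rho) (mu_gt0 : 0 < mu).
Let rho_gt0 : 0 < rho. Proof. exact: lt_trans ltr01 rho_gt1. Qed.
Let rho_neq0 : rho != 0. Proof. by rewrite gt_eqF. Qed.

(** As [size v - common_prefix_size v s] is the distance from [v] to the path
    from the root to [s], this is [mu ^ |v|] divided by the power of [rho] given
    by that distance, times the total weight of the moves from [v]. *)
Definition vertex_weight (T : tree) (s v : vertex) : R :=
  (mu / rho) ^+ size v * rho ^+ common_prefix_size v s *
  (#|` children T v|%:R + rho).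

Definition tree_weight (T : tree) (s : vertex) : R :=
  \sum_(v <- enum_fset T) vertex_weight T s v.

Lemma vertex_weight_ge0 T s v : 0 <= vertex_weight T s v.
Proof.
rewrite /vertex_weight !mulr_ge0 ?exprn_ge0 ?divr_ge0 ?ltW //.
by rewrite ltr_wpDl.
Qed.

Lemma vertex_weight_walk T s :
  vertex_weight T s s = mu ^+ size s * (#|` children T s|%:R + rho).
Proof. by rewrite /vertex_weight common_prefix_size_id -exprMn divfK. Qed.

Lemma tree_weight_walk T s : s \in T -> mu ^+ size s <= tree_weight T s.
Proof.
move=> sT; rewrite /tree_weight (big_rem s) //= vertex_weight_walk.
rewrite ler_wpDr ?sumr_ge0 // => [v _|]; first exact: vertex_weight_ge0.
rewrite ler_peMr ?exprn_ge0 ?(ltW mu_gt0) //.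
by rewrite ler_wpDl // ltW.
Qed.

(** A new leaf adds [mu ^ |s|] to the weight of [s], and its own weight is
    [(mu / rho) ^ (|s| + 1) * rho ^ |s| * rho = mu ^ (|s| + 1)]. *)
Lemma tree_weight_attach T s k : well_formed T -> s \in T ->
  tree_weight (attach T s k) s =
  tree_weight T s + (1 + mu) * mu ^+ size s * k%:R.
Proof.
move=> wT sT; rewrite /tree_weight.
set L := leaves s #|` children T s| k.
rewrite (perm_big (enum_fset T ++ enum_fset L)) /=; last first.
  apply: uniq_perm; rewrite ?fset_uniq //.
    rewrite cat_uniq !fset_uniq /= andbT; apply/hasPn => w wL.
    by apply/negP => wT'; move: (fdisjointP (leaves_new s k wT) _ wT'); rewrite wL.
  by move=> w; rewrite mem_cat in_fsetU.
rewrite big_cat /= [X in _ + X](eq_big_seq (fun=> mu ^+ (size s).+1)); last first.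
  move=> w wL; rewrite /vertex_weight (card_children_leaf wT sT wL) add0r.
  case/leavesP: wL => i -> _; rewrite common_prefix_size_rconsl size_rcons !exprS.
  have <- : (mu / rho) ^+ size s * rho ^+ size s = mu ^+ size s.
    by rewrite -exprMn divfK.
  by move: ((mu / rho) ^+ _) (rho ^+ _) => x y; field.
rewrite sum_cst_seq -/#|` L| card_leaves.
rewrite (bigD1_seq s) ?fset_uniq //= [in RHS](bigD1_seq s) ?fset_uniq //=.
rewrite (eq_bigr (vertex_weight T s)); last first.
  move=> v /negbTE vs.
  by rewrite /vertex_weight card_children_attach // vs addn0.
rewrite !vertex_weight_walk card_children_attach // eqxx mul1n natrD exprS.
ring.
Qed.

(** A loop at the root counts as a step further up, which divides all the
    weights by [rho]. *)
Definition discounted_weight (h : history) : R :=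
  rho^-1 ^+ root_loops h * tree_weight (tree_of h) (walk_of h).

Lemma discounted_weight_ge0 h : 0 <= discounted_weight h.
Proof.
rewrite mulr_ge0 ?exprn_ge0 ?invr_ge0 ?(ltW rho_gt0) // sumr_ge0 // => v _.
exact: vertex_weight_ge0.
Qed.

(** The path to the position is extended by [w], which becomes one step closer
    to [w] and its descendants only. *)
Lemma discounted_weight_down h k w :
  w \in children (branching_tree h k) (walk_of h) ->
  discounted_weight ((k, w) :: h) = rho^-1 ^+ root_loops h *
    \sum_(v <- enum_fset (branching_tree h k))
       vertex_weight (branching_tree h k) (walk_of h) v *
       (1 + (rho - 1) * (prefix w v)%:R).
Proof.
move=> /childrenP[i -> _]; rewrite /discounted_weight /=.
rewrite (_ : (rcons _ i == _) = false) ?andbF ?addn0; last by case: (walk_of h).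
congr (_ * _); apply: eq_bigr => v _.
rewrite /vertex_weight common_prefix_size_rcons exprD -!mulrA; congr (_ * (_ * _)).
rewrite mulrC; congr (_ * _).
by case: (prefix _ v); rewrite /= ?expr1 ?expr0; ring.
Qed.

(** The path to the position loses its last vertex, and this divides by [rho]
    the weights of its descendants. At the root they form the whole tree, and the
    division comes from the discount of the loop. *)
Lemma discounted_weight_up h k :
  discounted_weight ((k, father (walk_of h)) :: h) = rho^-1 ^+ root_loops h *
    \sum_(v <- enum_fset (branching_tree h k))
       vertex_weight (branching_tree h k) (walk_of h) v *
       (1 - (1 - rho^-1) * (prefix (walk_of h) v)%:R).
Proof.
rewrite /discounted_weight /= -/(branching_tree h k).
case/lastP: (walk_of h) => [|s i].
  rewrite /= exprD expr1 -mulrA mulr_sumr; congr (_ * _); apply: eq_bigr => v _.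
  rewrite prefix0s mulr1 /father /=; ring.
rewrite father_rcons (_ : (rcons _ i == _) = false) /= ?addn0; last by case: s.
congr (_ * _); apply: eq_bigr => v _.
rewrite /vertex_weight common_prefix_size_rcons exprD -!mulrA; congr (_ * (_ * _)).
rewrite [in RHS]mulrCA -[LHS]mulr1; congr (_ * _).
by case: (prefix _ v); rewrite /= ?expr1 ?expr0; [field|ring].
Qed.

(** What is lost on the way up is what is gained, in the mean, on the way
    down, except for the weight of the position itself. *)
Lemma discounted_weight_step h k : admissible h ->
  step_mean rho (branching_tree h k) (walk_of h)
    (fun v => discounted_weight ((k, v) :: h)) <=
  rho^-1 ^+ root_loops h * (tree_weight (branching_tree h k) (walk_of h) -
    (rho - 1) * mu ^+ size (walk_of h)).
Proof.
move=> adh; have [wT sT] := admissible_tree adh.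
set T := branching_tree h k; set s := walk_of h; set l := rho^-1 ^+ _.
have sT' : s \in T by apply/fsetUP; left.
have l0 : 0 <= l by rewrite exprn_ge0 // invr_ge0 ltW.
have K0 := card_rho_gt0 rho_gt0 T s.
rewrite /step_mean discounted_weight_up -/T -/s -/l.
rewrite [X in _ + X](eq_big_seq (fun w => l * \sum_(v <- enum_fset T)
  vertex_weight T s v * (1 + (rho - 1) * (prefix w v)%:R))); last first.
  by move=> w ws; exact: discounted_weight_down.
rewrite -mulr_sumr mulrCA -mulrDr -mulrA ler_wpM2l // ler_pdivrMr //.
rewrite exchange_big /= mulr_sumr -big_split /=.
have -> : (tree_weight T s - (rho - 1) * mu ^+ size s) *
    (#|` children T s|%:R + rho) =
  \sum_(v <- enum_fset T) vertex_weight T s v *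
    (#|` children T s|%:R + rho - (rho - 1) * (v == s)%:R).
  rewrite mulrBl -mulrA -vertex_weight_walk /tree_weight mulr_suml.
  rewrite [RHS](eq_bigr (fun v =>
     vertex_weight T s v * (#|` children T s|%:R + rho) -
     (rho - 1) * (vertex_weight T s v * (v == s)%:R))); last by move=> v _; ring.
  rewrite sumrB -mulr_sumr; congr (_ - _ * _).
  rewrite (bigD1_seq s) ?fset_uniq //= eqxx mulr1 big1 ?addr0 // => v /negbTE ->.
  by rewrite mulr0.
apply: ler_sum => v _; rewrite -mulr_sumr.
rewrite [X in X + _](_ : _ = vertex_weight T s v *
    (rho - (rho - 1) * (prefix s v)%:R)); last by field.
rewrite -mulrDr ler_wpM2l ?vertex_weight_ge0 //.
rewrite big_split /= sum_cst_seq mul1r -mulr_sumr -natr_sum.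
have := count_children_prefix T s v.
rewrite -(ler_nat R) natrD -sum1_count big_mkcond /=.
set a := (v == s)%:R; set b := (\sum_(_ <- _) _)%N; set c := (prefix s v)%:R.
move=> abc; have := ler_wpM2l (_ : 0 <= rho - 1) abc.
rewrite subr_ge0 => /(_ (ltW rho_gt1)); rewrite mulrDr; lra.
Qed.

(** The choice of [mu] for which the growth of the tree compensates exactly
    the loss at the position of the walk. *)
Lemma discounted_weight_drift (nu : probability nat R) :
  fine (mean nu) * (1 + mu) = rho - 1 ->
  mean_drift nu rho discounted_weight 1 0.
Proof.
set m := fine _ => hm h adh; have [wT sT] := admissible_tree adh.
pose l := rho^-1 ^+ root_loops h; pose M := mu ^+ size (walk_of h).
have l0 : 0 <= l by rewrite exprn_ge0 // invr_ge0 ltW.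
have M0 : 0 <= M by rewrite exprn_ge0 // ltW.
exists (l * (tree_weight (tree_of h) (walk_of h) - (rho - 1) * M)),
  (l * ((1 + mu) * M)), 0; split=> //.
- rewrite mulr_ge0 // subr_ge0 /tree_weight (big_rem (walk_of h)) //=.
  rewrite ler_wpDr ?sumr_ge0 // => [v _|]; first exact: vertex_weight_ge0.
  rewrite vertex_weight_walk mulrC ler_wpM2l //.
  have : 0 <= #|` children (tree_of h) (walk_of h)|%:R :> R by [].
  lra.
- by rewrite !mulr_ge0 // addr_ge0 // ltW.
- move=> k; apply: (le_trans (discounted_weight_step k adh)).
  rewrite mul0r addr0.
  rewrite /branching_tree tree_weight_attach // -/l -/M -!mulrA -mulrDr.
  by rewrite le_eqVlt; apply/orP; left; apply/eqP; ring.
- by rewrite mul0r !addr0 mul1r -/m -hm /discounted_weight -/l le_eqVlt;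
    apply/orP; left; apply/eqP; ring.
Qed.

End Weight.

(** * Descents *)

Lemma depth_branching (h : history) k :
  (depth (tree_of h) <= depth (branching_tree h k))%N.
Proof. by apply: depth_leq => v vT; apply: leq_depth; apply/fsetUP; left. Qed.

Section Descent.
Variables (R : realType) (rho p : R) (H : nat).
Hypotheses (rho_gt0 : 0 < rho) (p_gt0 : 0 < p) (p_lt1 : p < 1).

(** If each step went one level down with probability [p] and back to the root
    otherwise, the mean time to reach the level [H] from the level [l] would be
    [(p ^ (- H) - p ^ (- l)) / (1 - p)]. *)
Definition descent_gap (h : history) : R :=
  if (depth (tree_of h) < H)%N && (size (walk_of h) < H)%N
  then p^-1 ^+ H - p^-1 ^+ size (walk_of h) else 0.

Let q_ge1 : 1 <= p^-1. Proof. by rewrite invf_ge1 // ltW. Qed.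
Let q_gt0 : 0 < p^-1. Proof. by rewrite invr_gt0. Qed.

Lemma descent_gap_ge0 h : 0 <= descent_gap h.
Proof.
rewrite /descent_gap; case: ifP => // /andP[_ sH].
by rewrite subr_ge0 ler_weXn2l // ltnW.
Qed.

Lemma descent_gap_le h : (0 < H)%N -> descent_gap h <= p^-1 ^+ H - 1.
Proof.
move=> H0; rewrite /descent_gap; case: ifP => _.
  by rewrite lerD2l lerN2 exprn_ege1.
by rewrite subr_ge0 exprn_ege1.
Qed.

Lemma descent_gap_lower h : admissible h -> (depth (tree_of h) < H)%N ->
  p^-1 ^+ H * (1 - p) <= descent_gap h.
Proof.
move=> adh dH; have [_ /leq_depth sd] := admissible_tree adh.
have sH := leq_ltn_trans sd dH.
rewrite /descent_gap dH sH /=.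
case: H sH => // n; rewrite ltnS => sn.
rewrite exprS mulrBr mulr1 lerD2l lerN2 mulrAC mulVf ?mul1r ?gt_eqF //.
by rewrite ler_weXn2l.
Qed.

(** The gap is decreasing in the level, so the worst that can happen when the
    walk does not step to a child is a return to the root. Then the gap decreases
    by [1 - p] in the mean, which is at least [(1 - p) * p ^ H] times the gap. *)
Lemma descent_gap_drift (nu : probability nat R) : (nu [set 0%N] < 1)%E ->
  p = (1 - fine (nu [set 0%N])) / (1 + rho) ->
  mean_drift nu rho descent_gap (1 - (1 - p) * p ^+ H) 0.
Proof.
move=> nu01; set nu0 := fine _; pose p0 := 1 - nu0.
have p00 : 0 < p0 by rewrite subr_gt0 -lte_fin fineK ?nu_fin.
have nu0E : nu0 = 1 - p0 by rewrite /p0; ring.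
rewrite nu0E subKr => hp h adh; have [wT sT] := admissible_tree adh.
have [dH|Hd] := ltnP (depth (tree_of h)) H; last first.
  exists 0, 0, 0; split=> //.
    move=> k; rewrite !mul0r !addr0 (@step_mean_cst _ _ rho_gt0 _ _ 0) // => v.
    rewrite /descent_gap tree_of_cons ltnNge.
    by rewrite (leq_trans Hd (depth_branching _ _)).
  by rewrite !mul0r !addr0 /descent_gap ltnNge Hd /= mulr0.
have sH := leq_ltn_trans (leq_depth sT) dH.
have H0 : (0 < H)%N by case: H sH.
set s := walk_of h in sH *; set Q := p^-1.
(* the largest value of the gap, and a bound of its value at the children *)
pose W0 := Q ^+ H - 1; pose W1 := Q ^+ H - Q ^+ (size s).+1.
have W10 : 0 <= W1 by rewrite subr_ge0 ler_weXn2l.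
have W01E : W0 - W1 = Q ^+ (size s).+1 - 1 by rewrite /W0 /W1; ring.
have W01 : 0 <= W0 - W1 by rewrite W01E subr_ge0 exprn_ege1.
pose e := (1 + rho)^-1.
have e01 : 0 <= e <= 1.
  have r1 : 1 <= 1 + rho by rewrite lerDl ltW.
  by rewrite invr_ge0 invf_le1 ?r1 ?andbT; have := rho_gt0; lra.
case/andP: e01 => e0 e1.
exists (W0 - e * (W0 - W1)), 0, (e * (W0 - W1)); split=> //.
- have := ler_wpM2r W01 e1; rewrite mul1r; lra.
- by rewrite mulr_ge0.
- move=> k; rewrite mul0r addr0; set T := branching_tree h k.
  have K0 := card_rho_gt0 rho_gt0 T s.
  apply: (@le_trans _ _ ((rho * W0 + #|` children T s|%:R * W1) /
      (#|` children T s|%:R + rho))).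
    rewrite ler_wpM2r ?invr_ge0 ?(ltW K0) // lerD //.
      by rewrite ler_wpM2l ?(ltW rho_gt0) // descent_gap_le.
    rewrite mulrC -sum_cst_seq big_seq [leRHS]big_seq.
    apply: ler_sum => w /childrenP[i -> _].
    rewrite /descent_gap size_rcons; case: ifP => // _.
  rewrite ler_pdivrMr //.
  case: k @T K0 => [|k] T K0.
    rewrite /= mulr1 subrK.
    have : 0 <= #|` children T s|%:R * (W0 - W1) by rewrite mulr_ge0.
    rewrite /=; lra.
  rewrite /= mulr0 addr0.
  have K1 : 1 <= #|` children T s|%:R :> R.
    by rewrite ler1n /T card_children_branching // eqxx mul1n addnS.
  set K := #|` children T s|%:R in K0 K1 *.
  have eK : e * (K + rho) <= K.
    rewrite /e mulrC ler_pdivrMr; last by have := rho_gt0; lra.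
    by have := ler_wpM2r (ltW rho_gt0) K1; rewrite mul1r; lra.
  have := ler_wpM2r W01 eK; lra.
- rewrite mul0r !addr0 -/nu0 nu0E; have pQ : p * Q = 1 by rewrite divff // gt_eqF.
  have -> : W0 - e * (W0 - W1) + e * (W0 - W1) * (1 - p0) =
      Q ^+ H - Q ^+ size s - (1 - p).
    have pe : p0 * e = p by rewrite hp.
    rewrite W01E /W0 exprS.
    transitivity (Q ^+ H - 1 - (p0 * e) * (Q * Q ^+ size s - 1)); first by ring.
    rewrite pe mulrBr mulrA pQ; ring.
  rewrite /descent_gap dH sH /= -/Q -/s mulrBl mul1r lerD2l lerN2.
  have p1 : 0 <= 1 - p by rewrite subr_ge0 ltW.
  rewrite -mulrA -[leRHS]mulr1 ler_wpM2l // mulrBr -exprMn pQ expr1n.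
  by rewrite gerBl mulr_ge0 // exprn_ge0 // ltW.
Qed.

End Descent.

(** * Logarithmic bounds *)

Section Logarithms.
Variable R : realType.

(** The exponent [t] is such that [p ^ t >= (n + 1) ^ (- 1 / 2)], so that the
    left-hand side is of order [exp (- c * (n + 1) ^ (1 / 2))]; the factor 24
    comes from [exp x >= x ^ 4 / 4!]. *)
Lemma descent_failure_le (p : R) (n : nat) : 0 < p -> p < 1 ->
  (1 - (1 - p) *
     p ^+ (Num.truncn ((2 * ln p^-1)^-1 * ln n.+1%:R)).+1) ^+ n <=
  expR 1 * (24 / ((1 - p) * p) ^+ 4) / n.+1%:R ^+ 2.
Proof.
move=> p0 p1; set t := Num.truncn _; set N : R := n.+1%:R; set a := (1 - p) * p.
have N0 : 0 < N by rewrite ltr0n.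
have N1 : 1 <= N by rewrite ler1n.
have q1 : 1 < p^-1 by rewrite invf_gt1.
have lq0 : 0 < ln p^-1 by rewrite ln_gt0.
have a0 : 0 < a by rewrite mulr_gt0 // subr_gt0.
have a1 : a <= 1 by rewrite mulr_ile1 ?subr_ge0 ?ltW // gtrBl.
have pt0 : 0 < p ^+ t by rewrite exprn_gt0.
have pt1 : p ^+ t <= 1 by rewrite exprn_ile1 // ltW.
have qt : (p^-1 ^+ t) ^+ 2 <= N.
  have q0 : 0 < p^-1 by rewrite invr_gt0.
  rewrite -exprM -[X in X ^+ _]lnK ?posrE // -expRM_natr.
  rewrite -[leRHS]lnK ?posrE // ler_expR natrM.
  have : t%:R <= (2 * ln p^-1)^-1 * ln N.
    by rewrite truncn_le mulr_ge0 ?invr_ge0 ?mulr_ge0 ?ln_ge0 // ltW.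
  rewrite mulrC ler_pdivlMr ?mulr_gt0 // => h; apply: le_trans h.
  by rewrite le_eqVlt; apply/orP; left; apply/eqP; ring.
have ptN : N^-1 ^+ 2 <= (p ^+ t) ^+ 4.
  rewrite [4%N](_ : _ = 2 * 2)%N // exprM.
  rewrite ler_sqr ?nnegrE ?invr_ge0 ?exprn_ge0 ?(ltW N0) ?(ltW p0) //.
  rewrite -[leRHS]invrK lef_pV2 ?posrE ?invr_gt0 ?exprn_gt0 //.
  by rewrite -!exprVn.
rewrite exprS mulrA -/a; set x := a * p ^+ t.
have x0 : 0 < x by rewrite mulr_gt0.
have x1 : x <= 1 by rewrite mulr_ile1 // ltW.
have e1 : (1 - x) ^+ n <= expR (- x) ^+ n.
  by rewrite lerXn2r ?nnegrE ?subr_ge0 ?expR_ge0 // expR_ge1Dx.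
apply: (le_trans e1); rewrite -expRM_natr.
(* the factor [expR 1] accounts for the difference between [n] and [n + 1] *)
have -> : - x * n%:R = x + - (x * N) by rewrite /N -natr1; ring.
rewrite expRD -mulrA ler_pM ?expR_ge0 // ?ler_expR //.
have -> : 24 / a ^+ 4 / N ^+ 2 = (a ^+ 4 * N ^+ 2 / 24)^-1.
  by field; rewrite !gt_eqF.
rewrite expRN lef_pV2 ?posrE ?expR_gt0 //; last first.
  by apply: divr_gt0; [apply: mulr_gt0; exact: exprn_gt0 | rewrite ltr0n].
have xN0 : 0 <= x * N by rewrite mulr_ge0 ?(ltW x0) ?(ltW N0).
have h : 1 + (x * N) ^+ 4 / 24 <= expR (x * N) by exact: (expR_ge1Dxn 3 xN0).
have h24 : (x * N) ^+ 4 / 24 <= expR (x * N).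
  by apply: le_trans h; rewrite lerDr.
apply: le_trans h24.
rewrite ler_wpM2r ?invr_ge0 //.
have -> : (x * N) ^+ 4 = a ^+ 4 * ((p ^+ t) ^+ 4 * N ^+ 4).
  by rewrite /x 2!exprMn -[in LHS]mulrA.
apply: ler_wpM2l; first by rewrite exprn_ge0 // ltW.
apply: (@le_trans _ _ (N^-1 ^+ 2 * N ^+ 4)).
  rewrite le_eqVlt; apply/orP; left; apply/eqP; field.
  by rewrite gt_eqF.
by rewrite ler_wpM2r // exprn_ge0 // ltW.
Qed.

(** The bounds on the degree of the root and on [loop_weight] give [y ^ L <= N ^ 3 * (N ^ 3 + rho) <= N ^ 7]
    for the number [L] of loops, and the last one [mu ^ |s| <= rho ^ L * N ^ 3]
    for the position [s]. *)
Lemma size_walk_log (rho mu y N : R) (h : history) :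
  1 < rho -> 1 < mu -> 1 < y -> 1 + rho <= N -> admissible h ->
  (root_degree h)%:R <= N ^+ 3 -> loop_weight rho y h <= N ^+ 3 ->
  discounted_weight rho mu h <= N ^+ 3 ->
  (size (walk_of h))%:R <= (7 * (ln rho / ln y) + 3) / ln mu * ln N.
Proof.
move=> rho1 mu1 y1 N1 adh hK hL hW; have [_ sT] := admissible_tree adh.
have rho0 : 0 < rho by lra.
have mu0 : 0 < mu by lra.
have y0 : 0 < y by lra.
have N0 : 0 < N by lra.
have lr : 0 < ln rho by rewrite ln_gt0.
have lm : 0 < ln mu by rewrite ln_gt0.
have ly : 0 < ln y by rewrite ln_gt0.
set L := root_loops h.
have yL : y ^+ L <= N ^+ 7.
  move: hL; rewrite /loop_weight ler_pdivrMr ?card_rho_gt0 // => hL.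
  apply: (le_trans hL).
  have -> : N ^+ 7 = N ^+ 3 * N ^+ 4 by rewrite -exprD.
  apply: ler_wpM2l; first by rewrite exprn_ge0 // ltW.
  have N31 : 1 <= N ^+ 3 by rewrite exprn_ege1 //; lra.
  apply: (@le_trans _ _ (N ^+ 3 * (1 + rho))).
    by have := ler_wpM2l (ltW rho0) N31; rewrite mulr1 mulrDr mulr1 mulrC; lra.
  by rewrite [leRHS]exprSr ler_wpM2l // exprn_ge0 // ltW.
have {yL}hL' : L%:R <= 7 / ln y * ln N.
  move: yL; rewrite -ler_ln ?posrE ?exprn_gt0 // !lnXn //.
  rewrite -[ln y *+ _]mulr_natl -[ln N *+ _]mulr_natl -ler_pdivlMr // => h'.
  by apply: (le_trans h'); rewrite mulrAC.
have muS : mu ^+ size (walk_of h) <= rho ^+ L * N ^+ 3.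
  apply: (le_trans (tree_weight_walk rho1 mu0 sT)).
  rewrite mulrC -ler_pdivrMr ?exprn_gt0 // mulrC -exprVn.
  exact: hW.
move: muS; rewrite -ler_ln ?posrE ?mulr_gt0 ?exprn_gt0 //.
rewrite lnM ?posrE ?exprn_gt0 // !lnXn // -[ln mu *+ _]mulr_natl => hS.
rewrite mulrAC ler_pdivlMr //; apply: (le_trans hS).
rewrite -[ln rho *+ _]mulr_natl -[ln N *+ _]mulr_natl [leRHS]mulrDl lerD2r.
have := ler_wpM2r (ltW lr) hL'; move=> h'; apply: (le_trans h').
by rewrite le_eqVlt; apply/orP; left; apply/eqP; ring.
Qed.

End Logarithms.

Lemma nu_pos_le_mean (R : realType) (nu : probability nat R) :
  (mean nu < +oo)%E -> 1 - fine (nu [set 0%N]) <= fine (mean nu).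
Proof.
move=> hmean; rewrite lerBlDr -lee_fin -[1%:E](nu_total nu).
have := @law_affine _ nu hmean 0 1 1 (fun=> 1) (lexx _) ler01 ler01 (fun=> ler01).
rewrite add0r !mul1r => h; apply: le_trans (h _).
  rewrite nneseries_esumT //; apply: le_esum => k _; by rewrite mule1.
by case=> [|k]; rewrite add0r !mul1r ?add0r //= addr0 ler1n.
Qed.

Section Heights.
Variables (R : realType) (nu : probability nat R) (rho : R).
Hypotheses (nu0 : (nu [set 0%N] < 1)%E) (rho_gt0 : 0 < rho)
  (hmean : (1 + 2%:E * mean nu < rho%:E)%E).

Lemma mean_lty : (mean nu < +oo)%E.
Proof.
rewrite ltey; apply/eqP => mE; move: hmean; rewrite mE.
by rewrite mulry gtr0_sg // mul1e addey.
Qed.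

Let m := fine (mean nu).
Let p0 := 1 - fine (nu [set 0%N]).

Lemma rho_gt_mean : 1 + 2 * m < rho.
Proof.
move: hmean; rewrite -(fineK (mean_fin mean_lty)) -/m.
by rewrite -EFinM -EFinD lte_fin.
Qed.

Lemma nu_pos_gt0 : 0 < p0.
Proof. by rewrite subr_gt0 -lte_fin fineK ?nu_fin. Qed.

Lemma mean_gt0 : 0 < m.
Proof. exact: lt_le_trans nu_pos_gt0 (nu_pos_le_mean mean_lty). Qed.

Lemma rho_gt1 : 1 < rho.
Proof. by have := rho_gt_mean; have := mean_gt0; lra. Qed.

Definition growth_rate : R := (rho - 1 - m) / m.

Lemma growth_rate_gt1 : 1 < growth_rate.
Proof.
by rewrite ltr_pdivlMr ?mean_gt0 // mul1r; have := rho_gt_mean; lra.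
Qed.

Lemma growth_rateE : m * (1 + growth_rate) = rho - 1.
Proof. by rewrite /growth_rate; field; rewrite gt_eqF // mean_gt0. Qed.

(** Half of the probability that leaves are attached, as a value of
    [rho * (loop_base - 1)], is small enough for the loops to be compensated. *)
Definition loop_base : R := 1 + p0 / 2 / rho.

Lemma loop_base_gt1 : 1 < loop_base.
Proof. by rewrite ltrDl !divr_gt0 // nu_pos_gt0. Qed.

(** At least one leaf is attached with probability [p0], and then the walk steps
    to a child with probability at least [1 / (1 + rho)]. *)
Definition descent_prob : R := p0 / (1 + rho).

Lemma descent_prob_gt0 : 0 < descent_prob.
Proof. by rewrite divr_gt0 ?nu_pos_gt0 // addr_gt0. Qed.

Lemma descent_prob_lt1 : descent_prob < 1.
Proof.
rewrite ltr_pdivrMr ?addr_gt0 // mul1r.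
have : p0 <= 1 by rewrite gerBl fine_ge0.
by move: rho_gt0; lra.
Qed.

Definition upper_rate : R :=
  (7 * (ln rho / ln loop_base) + 3) / ln growth_rate.

Lemma upper_rate_gt0 : 0 < upper_rate.
Proof.
have ly : 0 < ln loop_base by rewrite ln_gt0 // loop_base_gt1.
have lr : 0 < ln rho by rewrite ln_gt0 // rho_gt1.
by rewrite divr_gt0 ?ln_gt0 ?growth_rate_gt1 // addr_gt0 // mulr_gt0 // divr_gt0.
Qed.

(** With [p = descent_prob] and [H = lower_rate * ln n] one has
    [p ^ H = n ^ (- 1 / 2)], so that [n] steps are many more than the
    [p ^ (- H)] needed to descend [H] times in a row. *)
Definition lower_rate : R := (2 * ln descent_prob^-1)^-1.

Lemma lower_rate_gt0 : 0 < lower_rate.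
Proof.
rewrite invr_gt0 mulr_gt0 // ln_gt0 // invf_gt1 ?descent_prob_gt0 //.
exact: descent_prob_lt1.
Qed.

Variables (d : measure_display) (Omega : measurableType d).
Variables (P : probability Omega R) (T : nat -> Omega -> tree)
  (S : nat -> Omega -> vertex) (xi : nat -> Omega -> nat).
Hypothesis HT : is_TBRW P rho nu T S xi.
Let hs := hist S xi.

Lemma eventually_bounded (F : history -> R) (beta : R) :
  (forall h, 0 <= F h) -> 0 <= beta -> mean_drift nu rho F 1 beta ->
  {ae P, forall om, \forall n \near \oo,
    admissible (hs n om) /\ (F (hs n om) <= n.+1%:R ^+ 3)%R}.
Proof.
move=> F0 be0 dF.
apply: (eventually_le_cube HT (C := F [::] + beta)) => //.
  by rewrite addr_ge0.
move=> n; apply: (le_trans (expectation_linear rho_gt0 HT mean_lty _ F0 be0 dF)).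
rewrite lee_fin mulrDl lerD //; first by rewrite ler_peMr // ler1n.
by rewrite ler_wpM2l // ler_nat.
Qed.

Lemma eventually_walk_log :
  {ae P, forall om, \forall n \near \oo, admissible (hs n om) /\
    (size (walk_of (hs n om)))%:R <= upper_rate * ln n.+1%:R}.
Proof.
have r1 := rho_gt1; have g1 := growth_rate_gt1; have y1 := loop_base_gt1.
have g0 : 0 < growth_rate := lt_trans ltr01 g1.
have m0 : 0 <= fine (mean nu) := ltW mean_gt0.
have h1 := eventually_bounded (fun h => ler0n R (root_degree h)) m0
  (root_degree_drift nu r1).
have hy : rho * (loop_base - 1) = p0 / 2.
  by rewrite /loop_base; field; rewrite gt_eqF.
have h2 := eventually_bounded
  (fun h => loop_weight_ge0 r1 h (ltW (lt_trans ltr01 y1))) (lexx 0)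
  (loop_weight_drift r1 nu0 hy).
have h3 := eventually_bounded (discounted_weight_ge0 r1 g0) (lexx 0)
  (discounted_weight_drift r1 g0 growth_rateE).
move: h1 h2 h3; apply: filterS3 => om.
have hN := nbhs_infty_ger (1 + rho).
apply: filter_app3.
apply: filterS hN => n hn [adh hK] [_ hL] [_ hW]; split=> //.
apply: (size_walk_log r1 g1 y1 _ adh hK hL hW).
by rewrite (le_trans hn) // ler_nat.
Qed.

(** The tree grows only next to the walk, so its vertices are those of the tree
    at the time [n0] after which the bound on the walk holds, and neighbours of
    later positions. *)
Lemma depth_log_eventually om :
  (\forall n \near \oo, admissible (hs n om) /\
    (size (walk_of (hs n om)))%:R <= upper_rate * ln n.+1%:R) ->
  \forall n \near \oo, admissible (hs n om) /\
    (depth (tree_of (hs n om)))%:R <= (upper_rate + 1) * ln n%:R.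
Proof.
case=> n0 _ hn0.
have u0 := upper_rate_gt0.
pose D : R := (depth (tree_of (hs n0 om)))%:R.
have key n v : (n0 <= n)%N -> v \in tree_of (hs n om) ->
    (size v)%:R <= Num.max D (upper_rate * ln n%:R + 1).
  elim: n v => [|n IH] v.
    rewrite leqn0 => /eqP n00 vT; rewrite le_max ler_nat; apply/orP; left.
    by apply: leq_depth; rewrite n00.
  rewrite leq_eqVlt => /predU1P[<- vT|].
    by rewrite le_max ler_nat leq_depth.
  rewrite ltnS => nn /fsetUP[vT|/leavesP[i -> _]].
    apply: (le_trans (IH _ nn vT)); rewrite ge_max !le_max lexx /=.
    apply/orP; right; rewrite lerD2r ler_wpM2l ?(ltW u0) //.
    case: n {IH nn vT} => [|n]; first by rewrite ln0 // ln1.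
    by rewrite ler_ln ?posrE ?ltr0n // ler_nat.
  rewrite le_max; apply/orP; right; rewrite size_rcons -natr1 lerD2r.
  by case: (hn0 n nn).
have hN := nbhs_infty_ger (expR (D + 1)).
apply: filterS2 hN (nbhs_infty_ge n0) => n hn nn; split.
  by case: (hn0 n nn).
have ln0n : D + 1 <= ln n%:R.
  rewrite -ler_expR lnK // posrE; exact: lt_le_trans (expR_gt0 _) hn.
have D0 : 0 <= D by [].
have ul : 0 <= upper_rate * ln n%:R.
  by rewrite mulr_ge0 ?(ltW u0) //; lra.
have : (depth (tree_of (hs n om)))%:R <= Num.max D (upper_rate * ln n%:R + 1).
  set B := Num.max _ _; have B0 : 0 <= B by rewrite le_max D0.
  rewrite -truncn_ge_nat //; apply: depth_leq => v vT.
  by rewrite truncn_ge_nat //; exact: key.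
rewrite le_max => /orP[] h; apply: (le_trans h); rewrite mulrDl mul1r; lra.
Qed.

Lemma eventually_depth_lower :
  {ae P, forall om, \forall n \near \oo,
    lower_rate * ln n%:R <= (depth (tree_of (hs n om)))%:R}.
Proof.
have p0' := descent_prob_gt0; have p1 := descent_prob_lt1.
set p := descent_prob in p0' p1.
pose H n := (Num.truncn (lower_rate * ln n.+1%:R)).+1.
pose B n : set history := [set h | (depth (tree_of h) < H n)%N].
pose C := (1 - p)^-1 * (expR 1 * (24 / ((1 - p) * p) ^+ 4)).
have p1' : 0 < 1 - p by rewrite subr_gt0.
have C0 : 0 <= C.
  rewrite mulr_ge0 ?invr_ge0 ?(ltW p1') // mulr_ge0 ?expR_ge0 //.
  by rewrite divr_ge0 // exprn_ge0 // mulr_ge0 ?(ltW p1') ?(ltW p0').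
have PB n : (P [set om | B n (hist S xi n om)] <= (C / n.+1%:R ^+ 2)%:E)%E.
  have q0 : 0 < p^-1 ^+ H n by rewrite exprn_gt0 // invr_gt0.
  have a0 : 0 < p^-1 ^+ H n * (1 - p) by rewrite mulr_gt0.
  apply: (le_trans (markov_hist HT n a0 (descent_gap_ge0 (H n) p0' p1) _)).
    by move=> h adh; exact: descent_gap_lower.
  have al0 : 0 <= 1 - (1 - p) * p ^+ H n.
    rewrite subr_ge0.
    rewrite mulr_ile1 ?exprn_ge0 ?exprn_ile1 ?(ltW p0') ?(ltW p1) ?(ltW p1') //.
    by rewrite gerBl ltW.
  have E := expectation_geometric rho_gt0 HT mean_lty n
    (descent_gap_ge0 (H n) p0' p1) al0
    (descent_gap_drift (H n) rho_gt0 p0' p1 nu0 (erefl p)).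
  apply: (le_trans (lee_wpmul2l _ E)); first by rewrite lee_fin invr_ge0 ltW.
  rewrite -EFinM lee_fin.
  have F0 : descent_gap p (H n) [::] <= p^-1 ^+ H n.
    apply: (le_trans (descent_gap_le p0' p1 [::] _)) => //.
    by rewrite gerBl.
  apply: (@le_trans _ _ ((p^-1 ^+ H n * (1 - p))^-1 *
      ((1 - (1 - p) * p ^+ H n) ^+ n * p^-1 ^+ H n))).
    by rewrite ler_wpM2l ?invr_ge0 ?(ltW a0) // ler_wpM2l // exprn_ge0.
  rewrite (_ : _ * _ = (1 - p)^-1 * (1 - (1 - p) * p ^+ H n) ^+ n); last first.
    by move: (_ ^+ n) (p^-1 ^+ H n) q0 => x q q0; field; rewrite !gt_eqF.
  rewrite /C -mulrA ler_wpM2l ?invr_ge0 ?(ltW p1') //.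
  exact: descent_failure_le.
have := eventually_not_hist HT C0 PB; apply: filterS => om.
apply: filterS => n /negP; rewrite -leqNgt => nH.
have [->|n0] := posnP n; first by rewrite ln0 // mulr0.
apply: (@le_trans _ _ (lower_rate * ln n.+1%:R)).
  rewrite ler_wpM2l ?(ltW lower_rate_gt0) // ler_ln ?posrE ?ltr0n // ler_nat.
  exact: leqnSn.
apply: ltW; apply: (lt_le_trans (real_truncnS_gt _)); first exact: num_real.
by rewrite ler_nat.
Qed.

Lemma eventually_height_log :
  {ae P, forall om, \forall n \near \oo,
    lower_rate * ln n%:R <= (height (T n om))%:R <=
    (upper_rate + 1) * ln n%:R}.
Proof.
have h1 := eventually_walk_log; have h2 := eventually_depth_lower.
move: h1 h2; apply: filterS2 => om /depth_log_eventually; apply: filterS2.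
move=> n [adh up] low.
have [wT _] := admissible_tree adh.
by rewrite (hist_tree HT) height_depth // low up.
Qed.

End Heights.

Unset Implicit Arguments.

Theorem theorem1p4 (R : realType) (nu : probability nat R) (rho : R)
  (hnu0 : (nu [set 0%N] < 1)%E)
  (hrho : 0 < rho)
  (hmean : (1 + 2%:E * mean nu < rho%:E)%E) :
  exists c1 c2 : R, [/\ 0 < c1, 0 < c2 &
    forall (d : measure_display) (Omega : measurableType d)
      (P : probability Omega R)
      (T : nat -> Omega -> tree) (S : nat -> Omega -> vertex)
      (xi : nat -> Omega -> nat),
      is_TBRW P rho nu T S xi ->
      {ae P, forall om, \forall n \near \oo,
        c1 * ln n%:R <= (height (T n om))%:R <= c2 * ln n%:R}].
Proof.
exists (lower_rate nu rho), (upper_rate nu rho + 1); split.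
- exact: lower_rate_gt0.
- by rewrite addr_gt0 // upper_rate_gt0.
- by move=> d Omega P T S xi; exact: eventually_height_log.
Qed.
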